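(* Let $D$ be a digraph such that every proper induced subdigraph of $D$ satisfies the BE-property. If $\alpha(D) \geq \frac{|V(D)|}{2}$, then $D$ satisfies the BE-property.
   Context: All digraphs are finite, without loops and without multiple edges (a pair of opposite edges $uv$, $vu$ is allowed). Two vertices $u,v$ are adjacent if $uv$ or $vu$ is an edge. A stable set is a set of pairwise non-adjacent vertices; $\alpha(D)$ is the maximum cardinality of a stable set of $D$, and a maximum stable set is one of cardinality $\alpha(D)$. A path is a directed path $v_1v_2\dots v_k$ with distinct vertices ($k\ge 1$; a single vertex is a path); it starts at $v_1$ and ends at $v_k$. A path partition of $D$ is a collection $\mathcal{P}$ of paths of $D$ such that every vertex of $D$ belongs to exactly one path of $\mathcal{P}$. A stable set $S$ and a path partition $\mathcal{P}$ are orthogonal if $|V(P)\cap S|=1$ for every $P\in\mathcal{P}$. An $S_{BE}$-path partition of $D$ is a path partition $\mathcal{P}$ such that $\mathcal{P}$ and $S$ are orthogonal and every vertex of $S$ starts or ends a path of $\mathcal{P}$. A digraph $D$ satisfies the BE-property if for every maximum stable set $S$ of $D$ there exists an $S_{BE}$-path partition of $D$. *)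

(* Defs.v *)
From mathcomp Require Import all_boot.

Set Implicit Arguments.
Unset Strict Implicit.
Unset Printing Implicit Defensive.

(* [edge u v] is the directed edge uv; u v and v u may both be edges. *)
Record digraph := Digraph {
  vertex :> finType;
  edge : rel vertex;
  loopless : irreflexive edge
}.

Arguments edge {d} u v.

Lemma induced_loopless (D : digraph) (U : {set D}) :
  irreflexive (fun u v : {x : D | x \in U} => edge (val u) (val v)).
Proof. by move=> u; apply: loopless. Qed.

Definition induced (D : digraph) (U : {set D}) : digraph :=
  @Digraph {x : D | x \in U} (fun u v => edge (val u) (val v))
    (@induced_loopless D U).

Arguments induced D U : clear implicits.

Section BE.

Variable D : digraph.
Implicit Types (S : {set D}) (p : seq D) (P : seq (seq D)).

Definition adjacent (u v : D) : bool := edge u v || edge v u.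

Definition stable S : bool :=
  [forall u in S, forall v in S, (u != v) ==> ~~ adjacent u v].

Definition alpha : nat := \max_(S : {set D} | stable S) #|S|.

Definition maximum_stable S : bool := stable S && (#|S| == alpha).

(* A path v_1 ... v_k is given by its nonempty list of vertices. *)
Definition dipath p : bool :=
  if p is v :: q then path edge v q && uniq p else false.

Definition starts (v : D) p : bool := if p is u :: _ then u == v else false.

Definition ends (v : D) p : bool :=
  if p is u :: q then last u q == v else false.

(* The collection is listed in an arbitrary order; since paths are nonempty,
   the counting condition excludes repetitions in the list. *)
Definition path_partition P : Prop :=
  (forall p, p \in P -> dipath p) /\
  (forall v : D, count (fun p => v \in p) P = 1).

Definition orthogonal S P : Prop :=
  forall p, p \in P -> #|[set v in p] :&: S| = 1.

Definition BE_path_partition S P : Prop :=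
  [/\ path_partition P,
      orthogonal S P
    & forall v, v \in S -> exists2 p, p \in P & starts v p || ends v p].

Definition BE_property : Prop :=
  forall S, maximum_stable S -> exists P, BE_path_partition S P.

End BE.

(* Main.v *)
(** Let [S] be a maximum stable set and [T] its complement.  Take a set [X] of
    vertices of [T] of largest deficiency for Hall's condition, and let [U]
    consist of [X] and of its neighbours in [S].  By the choice of [X], the
    vertices of [T] outside [U] can be matched to adjacent vertices of [S]
    outside [U], which partitions the complement of [U] into paths with at most
    two vertices.  No vertex of [U] is adjacent to [S :\: U], so [S :&: U] is a
    maximum stable set of the subdigraph induced by [U], and the hypothesis
    applies if [U] is proper.  If [U] is everything then the largest deficiency
    is [#|T| - #|S| <= 0], so all of [T] can be matched into [S]. *)
Require Import Defs.
From mathcomp Require Import all_boot.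
From mathcomp Require Import zify.

Set Implicit Arguments.
Unset Strict Implicit.
Unset Printing Implicit Defensive.

(** * Hall's marriage theorem and sets of largest deficiency *)

Lemma bigcup_setDl (T U : finType) (N : T -> {set U}) (B : {set U})
    (Y : {set T}) :
  \bigcup_(x in Y) (N x :\: B) = (\bigcup_(x in Y) N x) :\: B.
Proof.
by rewrite setDE big_distrl /=; apply: eq_bigr => x _; apply: setDE.
Qed.

Lemma card_bigcup_setU (T U : finType) (N : T -> {set U}) (X Y : {set T}) :
  #|\bigcup_(x in X :|: Y) N x| =
    #|\bigcup_(x in X) N x| +
     #|\bigcup_(x in Y) (N x :\: \bigcup_(x in X) N x)|.
Proof.
rewrite bigcup_setU cardsU bigcup_setDl cardsD [in LHS]setIC -addnBA //.
by rewrite subset_leq_card // subsetIl.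
Qed.

(* [f0] only provides values outside [A]: there may be no function at all when
   [A] and [U] are empty. *)
Lemma hall_matching (T U : finType) (f0 : T -> U) (N : T -> {set U})
    (A : {set T}) :
    (forall Y : {set T}, Y \subset A -> #|Y| <= #|\bigcup_(x in Y) N x|) ->
  exists2 f : T -> U, {in A &, injective f} & {in A, forall x, f x \in N x}.
Proof.
have [n] := ubnP #|A|; elim: n => // n IHn in N A * => ltAn hallA.
have [-> | [x xA]] := set_0Vmem A.
  by exists f0 => x; rewrite inE.
(* Together with [hallA], a tight set attains equality in Hall's condition. If one exists, [Y] and
   [A :\: Y] are matched separately by induction, the latter avoiding the neighbours of [Y]. *)
pose tight (Y : {set T}) :=
  [&& Y \proper A, Y != set0 & #|\bigcup_(x in Y) N x| <= #|Y|].
have [Y /and3P[pYA nY tY] | slack] := pickP tight.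
  have sYA := proper_sub pYA; set NY := \bigcup_(x in Y) N x in tY.
  have cYA := proper_card pYA.
  have [|Z sZY|f finj fN] := IHn N Y; first lia.
    by apply/hallA/(subset_trans sZY).
  have [||g ginj gN] := IHn (fun x => N x :\: NY) (A :\: Y).
  - by move: nY; rewrite cardsDS // -card_gt0; lia.
  (* Hall's condition for [Z :|: Y] gives at least [#|Z| + #|Y|] neighbours, of which at most [#|Y|]
     lie in [NY]. *)
  - move=> Z /subsetDP[sZA dZY].
    have := hallA (Z :|: Y); rewrite subUset sZA sYA => /(_ isT).
    rewrite [in X in _ <= X]setUC card_bigcup_setU -/NY.
    move: dZY; rewrite -leq_card_setU => /eqP ->; lia.
  have gY z : z \in A -> z \notin Y -> g z \notin NY /\ g z \in N z.
    by move=> zA zY; apply/andP; rewrite -in_setD gN // inE zA zY.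
  have fY z : z \in Y -> f z \in NY.
    by move=> zY; apply/bigcupP; exists z => //; apply: fN.
  exists (fun z => if z \in Y then f z else g z) => [u v uA vA|z zA].
    have [uY|uY] := boolP (u \in Y); have [vY|vY] := boolP (v \in Y).
    - exact: finj.
    - by move=> e; have [] := gY v vA vY; rewrite -e fY.
    - by move=> e; have [] := gY u uA uY; rewrite e fY.
    - by apply: ginj; rewrite inE ?uY ?vY.
  by case: ifPn => zY; [apply: fN | have [] := gY z zA zY].
(* Without tight sets, every nonempty proper subset of [A] has a neighbour to spare. So [x] may be
   matched to any neighbour [y]: deleting [y] costs each remaining set at most one neighbour. *)
have [y yNx] : exists y, y \in N x.
  apply/set0Pn; rewrite -card_gt0.
  by have := hallA [set x]; rewrite big_set1 cards1; apply; rewrite sub1set.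
have [||f finj fN] := IHn (fun z => N z :\ y) (A :\ x).
- by move: ltAn; rewrite (cardsD1 x A) xA; lia.
- move=> Z /subsetD1P[sZA xZ].
  have [->|nZ] := eqVneq Z set0; first by rewrite cards0.
  have pZA : Z \proper A by apply/properP; split=> //; exists x.
  have := slack Z; rewrite /tight pZA nZ /= => /negbT.
  rewrite bigcup_setDl.
  by rewrite (cardsD1 y (\bigcup_(z in Z) N z)); case: (y \in _); lia.
exists (fun z => if z == x then y else f z) => [u v uA vA|z zA].
  have fy z : z \in A -> z != x -> f z != y.
    move=> zA zx; have: f z \in N z :\ y by apply: fN; rewrite !inE zx.
    by case/setD1P.
  case: ifPn => [/eqP->|ux]; case: ifPn => [/eqP->|vx] // e.
  - by have := fy v vA vx; rewrite -e eqxx.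
  - by have := fy u uA ux; rewrite e eqxx.
  - by apply: finj => //; rewrite !inE ?ux ?vx.
case: ifPn => [/eqP-> //|zx].
have: f z \in N z :\ y by apply: fN; rewrite !inE zx.
by case/setD1P.
Qed.

(** The minimised sum is [#|A|] minus the deficiency of [X]. Enlarging [X] by [Y] changes the
    deficiency by [#|Y|] minus the number of new neighbours, and by minimality this change is not
    positive. *)
Lemma card_deficiency_outside (T U : finType) (N : T -> {set U})
    (A X : {set T}) :
    X \subset A ->
    (forall Y : {set T}, Y \subset A ->
       #|\bigcup_(x in X) N x| + #|A :\: X|
         <= #|\bigcup_(x in Y) N x| + #|A :\: Y|) ->
  forall Y : {set T}, Y \subset A :\: X ->
    #|Y| <= #|\bigcup_(x in Y) (N x :\: \bigcup_(x in X) N x)|.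
Proof.
move=> sXA minX Y /subsetDP[sYA dYX].
have := minX (X :|: Y); rewrite subUset sXA sYA => /(_ isT).
rewrite card_bigcup_setU.
have := subset_leq_card sXA.
have : #|X :|: Y| <= #|A| by rewrite subset_leq_card // subUset sXA.
rewrite !cardsDS ?subUset ?sXA //.
move: dYX; rewrite disjoint_sym -leq_card_setU => /eqP ->; lia.
Qed.

(** * Stable sets and path partitions of a part of the vertex set *)

Lemma dipath_uniq (D : digraph) (p : seq D) : dipath p -> uniq p.
Proof. by case: p => //= x p /andP[]. Qed.

Lemma card_seq_setI (T : finType) (X : {set T}) (p : seq T) :
  uniq p -> #|[set v in p] :&: X| = count [in X] p.
Proof.
move=> up; rewrite -size_filter -(card_uniqP (filter_uniq _ up)).
by apply: eq_card => v; rewrite !inE mem_filter andbC.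
Qed.

Lemma adjacentC (D : digraph) : symmetric (@adjacent D).
Proof. by move=> u v; rewrite /adjacent orbC. Qed.

Lemma stableP (D : digraph) (A : {set D}) :
  reflect {in A &, forall u v, u != v -> ~~ adjacent u v} (stable A).
Proof.
apply: (iffP forall_inP) => [sA u v uA vA | sA u uA].
  by apply/implyP; move: (sA u uA) => /forall_inP/(_ v vA).
by apply/forall_inP=> v vA; apply/implyP; apply: sA.
Qed.

Lemma stable_leq_alpha (D : digraph) (A : {set D}) :
  stable A -> #|A| <= alpha D.
Proof. by move=> stA; rewrite /alpha (bigmax_sup A). Qed.

Section BEPartitionOn.

Variables (D : digraph) (S : {set D}).
Implicit Types (A B U : {set D}) (P Q : seq (seq D)).

(** The paths stay lists over [D], so that partitions of disjoint vertex sets can simply be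
    concatenated. The count also forces every path to lie inside [A]. *)
Definition BE_partition_on A P : Prop :=
  [/\ forall p, p \in P -> dipath p,
      forall v, count (fun p => v \in p) P = (v \in A),
      orthogonal S P
    & forall v, v \in S :&: A -> exists2 p, p \in P & starts v p || ends v p].

Lemma BE_partition_onT P : BE_partition_on setT P -> BE_path_partition S P.
Proof.
by case=> dP cP oP eP; split=> // [|v vS];
  [split=> // v; rewrite cP inE | apply: eP; rewrite !inE vS].
Qed.

Lemma BE_partition_onU A B P Q :
    [disjoint A & B] -> BE_partition_on A P -> BE_partition_on B Q ->
  BE_partition_on (A :|: B) (P ++ Q).
Proof.
move=> dAB [dP cP oP eP] [dQ cQ oQ eQ]; split.
- by move=> p; rewrite mem_cat => /orP[/dP|/dQ].
- move=> v; rewrite count_cat cP cQ inE.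
  by have [vA|] := boolP (v \in A); rewrite ?(disjointFr dAB vA).
- by move=> p; rewrite mem_cat => /orP[/oP|/oQ].
- move=> v; rewrite setIUr => /setUP[/eP|/eQ] [p pP vp];
    by exists p; rewrite // mem_cat pP ?orbT.
Qed.

(** Each [s] in [B] forms a path with its partner in [A], or alone if it has none. On at most two
    vertices [s] is an endpoint whichever way the edge points, and the partner lies outside [S]. *)
Lemma BE_partition_on_matching (A B : {set D}) (f : D -> D) :
    [disjoint A & S] -> B \subset S -> {in A &, injective f} ->
    {in A, forall x, f x \in B /\ adjacent x (f x)} ->
  exists P, BE_partition_on (A :|: B) P.
Proof.
move=> dAS sBS finj fAB.
pose path_of s := if [pick t | (t \in A) && (f t == s)] is Some t then
  if edge s t then [:: s; t] else [:: t; s] else [:: s].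
have notAS t : t \in A -> t \notin S by move=> tA; rewrite (disjointFr dAS tA).
have path_ofP s : s \in B ->
  [/\ dipath (path_of s), count [in S] (path_of s) = 1,
    starts s (path_of s) || ends s (path_of s)
    & forall v, (v \in path_of s) = (v == s) || (v \in A) && (f v == s)].
  move=> sB; have sS := subsetP sBS s sB.
  have sA : s \notin A by apply: contraL sS; apply: notAS.
  rewrite /path_of; case: pickP => [t /andP[tA /eqP fts]|none].
    have ts : t != s by apply: contraNneq sA => <-.
    have [_] := fAB t tA; rewrite fts /adjacent => adj.
    have memP v : (v \in [:: s; t]) = (v == s) || (v \in A) && (f v == s).
      rewrite !inE; congr (_ || _); apply/eqP/andP=> [->|[vA /eqP fvs]].
        by rewrite tA fts.
      by apply: finj => //; rewrite fvs fts.
    case: ifPn => st; split=> //=.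
    - by rewrite st !inE eq_sym ts.
    - by rewrite sS (negPf (notAS t tA)).
    - by rewrite eqxx.
    - by move: adj; rewrite (negPf st) orbF !inE ts => ->.
    - by rewrite sS (negPf (notAS t tA)).
    - by rewrite eqxx orbT.
    - by move=> v; rewrite -memP !inE orbC.
  by split=> //= [||v]; rewrite ?sS ?eqxx // inE none orbF.
(* [owner v] indexes the only path through [v] when [v] is in [A :|: B]; elsewhere its value is
   irrelevant. *)
pose owner v := if v \in B then v else f v.
exists [seq path_of s | s <- enum B]; split.
- by move=> p /mapP[s]; rewrite mem_enum => /path_ofP[dp _ _ _] ->.
- move=> v; rewrite count_map inE.
  have notAB : v \in A -> v \notin B.
    by move=> /notAS; apply: contra; apply: (subsetP sBS).
  rewrite (@eq_in_count _ _ (fun s => (v \in A :|: B) && (s == owner v))).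
    have [vAB|vAB] := boolP (v \in A :|: B); last first.
      by rewrite count_pred0 -in_setU (negPf vAB).
    rewrite (count_uniq_mem _ (enum_uniq _)) mem_enum -in_setU vAB /owner.
    case: ifPn => [-> //|vB]; move: vAB; rewrite inE (negPf vB) orbF => vA.
    by have [->] := fAB v vA.
  move=> s; rewrite mem_enum /= => sB; have [_ _ _ ->] := path_ofP s sB.
  rewrite inE /owner; have [vB|vB] := boolP (v \in B).
    have /negPf-> : v \notin A by apply: contraL vB.
    by rewrite orbF eq_sym.
  rewrite orbF [f v == s]eq_sym.
  by have [vs|//] := eqVneq v s; rewrite vs sB in vB.
- move=> p /mapP[s]; rewrite mem_enum => /path_ofP[dp cp _ _] ->.
  by rewrite card_seq_setI // dipath_uniq.
- move=> v /setIP[vS]; rewrite inE => /orP[/notAS|vB]; first by rewrite vS.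
  by exists (path_of v); [rewrite map_f ?mem_enum | have [] := path_ofP v vB].
Qed.

(** A stable set [Z] inside [U] remains stable when [S :\: U] is added, so
    [#|Z| + #|S :\: U| <= #|S|]. *)
Lemma maximum_stable_induced U :
    maximum_stable S ->
    {in U & S :\: U, forall u s, ~~ adjacent u s} ->
  maximum_stable [set u : induced D U | val u \in S].
Proof.
case/andP=> /stableP stS /eqP cS sepU.
have val_inj' : injective (val : induced D U -> D) by apply: val_inj.
have stS' : stable [set u : induced D U | val u \in S].
  rewrite /stable; apply/forall_inP=> u; rewrite inE => uS.
  apply/forall_inP=> v; rewrite inE => vS; apply/implyP=> uv.
  by apply: (stS (val u) (val v)); rewrite // (inj_eq val_inj').
rewrite /maximum_stable stS' eqn_leq.
rewrite stable_leq_alpha //=.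
apply/bigmax_leqP=> Z stZ.
have imZ : [disjoint val @: Z & S :\: U].
  rewrite disjoint_subset; apply/subsetP=> _ /imsetP[z _ ->].
  by rewrite !inE (valP z).
have stZS : stable ((val @: Z) :|: (S :\: U)).
  apply/stableP=> u v /setUP[/imsetP[u' uZ ->]|uS] /setUP[/imsetP[v' vZ ->]|vS].
  - move=> uv; move: stZ => /forall_inP/(_ u' uZ)/forall_inP/(_ v' vZ).
    by rewrite -(inj_eq val_inj') uv.
  - by move=> _; apply: sepU => //; apply: valP.
  - by move=> _; rewrite adjacentC; apply: sepU => //; apply: valP.
  - by apply: stS; [case/setDP: uS | case/setDP: vS].
have := stable_leq_alpha stZS; rewrite -cS.
move: imZ; rewrite -leq_card_setU => /eqP ->.
rewrite card_imset // -(cardsID U S) leq_add2r => /leq_trans; apply.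
have -> : S :&: U = val @: [set u : induced D U | val u \in S].
  apply/setP=> v; apply/setIP/imsetP=> [[vS vU]|[u]].
    by exists (Sub v vU); rewrite ?inE.
  by rewrite inE => uS ->; split; last apply: valP.
by rewrite card_imset.
Qed.

Lemma BE_partition_on_induced U (P : seq (seq (induced D U))) :
    BE_path_partition [set u : induced D U | val u \in S] P ->
  BE_partition_on U (map (map val) P).
Proof.
have val_inj' : injective (val : induced D U -> D) by apply: val_inj.
case=> -[dP cP] oP eP.
have dvP p : p \in P -> dipath (map val p : seq D).
  move/dP; case: p => //= x p /andP[xp up].
  by rewrite path_map xp (mem_map val_inj') (map_inj_uniq val_inj').
split.
- by move=> _ /mapP[p pP ->]; apply: dvP.
- move=> v; rewrite count_map; have [vU|vU] := boolP (v \in U).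
    rewrite -[RHS](cP (Sub v vU : induced D U)); apply: eq_count => p /=.
    by rewrite -(mem_map val_inj').
  rewrite (@eq_count _ _ pred0) ?count_pred0 // => p /=.
  by apply: contraNF vU => /mapP[u _ ->]; apply: valP.
- move=> _ /mapP[p pP ->]; rewrite card_seq_setI ?(dipath_uniq (dvP p pP)) //.
  rewrite count_map -(oP p pP) card_seq_setI ?(dipath_uniq (dP p pP)) //.
  by apply: eq_count => u; rewrite /= inE.
- move=> v /setIP[vS vU].
  have [|p pP vp] := eP (Sub v vU : induced D U); first by rewrite inE.
  exists (map val p); first exact: map_f.
  by move: vp; case: p {pP} => //= x p; rewrite last_map -!(inj_eq val_inj').
Qed.

End BEPartitionOn.

(** * Gluing the inductive partition and the matching *)

Theorem theorem14 (D : digraph)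
  (hD : forall U : {set D}, U \proper [set: D] -> BE_property (induced D U))
  (halpha : #|D| <= 2 * alpha D) :
  BE_property D.
Proof.
move=> S maxS; have /andP[stS /eqP cS] := maxS.
pose N x := [set s in S | adjacent x s].
pose NN (X : {set D}) := \bigcup_(x in X) N x.
have sNNS X : NN X \subset S.
  by apply/bigcupsP=> x _; apply/subsetP=> s; rewrite inE => /andP[].
(* Stated for any [X], since it serves both the extremal set and, when [U] is everything, the empty
   set. *)
have part_outside (X : {set D}) : X \subset ~: S ->
    (forall Y : {set D}, Y \subset ~: S :\: X ->
       #|Y| <= #|\bigcup_(x in Y) (N x :\: NN X)|) ->
    exists P, BE_partition_on S ((~: S :\: X) :|: (S :\: NN X)) P.
  move=> sXS /(hall_matching id)[f finj fN].
  apply: (@BE_partition_on_matching _ S _ _ f) => //.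
  - by rewrite disjoints_subset subsetDl.
  - exact: subsetDl.
  - by move=> x /fN; rewrite !inE => /and3P[-> -> ->].
(* For [X] inside [~: S], minimising this sum maximises [#|X| - #|NN X|] while avoiding truncated
   subtraction. *)
pose defect (X : {set D}) := #|NN X| + #|~: S :\: X|.
pose X := [arg min_(X < set0 : {set D} | X \subset ~: S) defect X].
have [sXS minX] : X \subset ~: S /\
    (forall Y : {set D}, Y \subset ~: S -> defect X <= defect Y).
  by rewrite /X; case: arg_minnP => [|Y sY minY]; rewrite ?sub0set.
have [Q partQ] := part_outside X sXS (card_deficiency_outside sXS minX).
pose U := X :|: NN X.
have [pU|] := boolP (U \proper setT).
  have sepU : {in U & S :\: U, forall u s, ~~ adjacent u s}.
    move=> u s uU /setDP[sS]; rewrite inE negb_or => /andP[sX sNX].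
    case/setUP: uU => [uX|uN].
      by apply: contra sNX => us; apply/bigcupP; exists u; rewrite // inE sS.
    apply: (stableP _ stS) => //; first exact: (subsetP (sNNS X)).
    by apply: contraNneq sNX => <-.
  have [P /BE_partition_on_induced partP] :=
    hD U pU _ (maximum_stable_induced maxS sepU).
  exists (map (map val) P ++ Q); apply: BE_partition_onT.
  have -> : setT = U :|: ((~: S :\: X) :|: (S :\: NN X)).
    apply/setP=> v; rewrite !inE.
    by case: (v \in S); case: (v \in X); case: (v \in NN X).
  apply: BE_partition_onU partP partQ.
  rewrite -setI_eq0; apply/eqP/setP=> v; rewrite !inE.
  have := subsetP sXS v; have := subsetP (sNNS X) v; rewrite !inE.
  by case: (v \in S); case: (v \in X); case: (v \in NN X) => // h1 h2;
    by first [have := h1 isT | have := h2 isT].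
rewrite properT negbK => /eqP UT.
have leS : #|S| <= #|NN X|.
  apply/subset_leq_card/subsetP=> s sS.
  have := in_setT s; rewrite -UT => /setUP[/(subsetP sXS)|//].
  by rewrite inE sS.
(* Hall's condition on all of [~: S]: [defect Y >= defect X >= #|S| >= #|~: S|], the last step by
   [halpha], and hence [#|NN Y| >= #|Y|]. *)
have [|Y|P partP] := part_outside set0; first exact: sub0set.
  rewrite setD0 /NN big_set0 => sYS.
  under eq_bigr do rewrite setD0.
  have := minX Y sYS; rewrite /defect [#|_ :\: Y|]cardsDS //.
  have := cardsC S; have := subset_leq_card sYS; rewrite -/(NN Y).
  move: halpha; rewrite -cS; lia.
exists P; apply: BE_partition_onT; move: partP.
by rewrite /NN big_set0 !setD0 setUC setUCr.
Qed.
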